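(* Let $n\geq1$ be an integer. Then $n$ is a power of $2$ (including $n=1$) if and only if $n$ is neither even-trapezoidal nor the semi-perimeter of a Pythagorean triangle. Furthermore, with $R:=\{2^m:m\in\mathbb{Z}_{\geq0}\}$ and $S$ the set of $n\geq1$ that are neither even-trapezoidal nor semi-perimeters of Pythagorean triangles, the statement ''$R=S$'' is provable in $\mathbf{KR}_{2}$, i.e. $R,S\in\mathfrak{U}_{\mathbf{KR}_{2}}$ and $\gamma(R)=\gamma(S)$ where $\gamma(n)=\langle\!\langle n\rangle\!\rangle_{2}$.
   Context: $n\geq1$ is even-trapezoidal if $n=\sum_{k=0}^{2m-1}(a+k)$ for some integers $a\geq1$, $m\geq1$. $n$ is the semi-perimeter of a Pythagorean triangle if there exist integers $x,y,z\geq1$ with $x^2+y^2=z^2$ and $(x+y+z)/2=n$. For $n\geq1$, let $D_n$ be the set of divisors of $n$, $2D_n=\{2d:d\in D_n\}$, and $u_1<\dots<u_k$ the elements of $D_n\triangle 2D_n$; the word $\langle\!\langle n\rangle\!\rangle_{2}=w_1\cdots w_k\in\{a,b\}^{\ast}$ has $w_i=a$ if $u_i\in D_n\setminus2D_n$ and $w_i=b$ if $u_i\in2D_n\setminus D_n$. $\mathbf{KR}_{2}$ is the triple $(\mathbb{Z}_{\geq1},\{a,b\},\gamma)$ with $\gamma(n)=\langle\!\langle n\rangle\!\rangle_{2}$, and $\mathfrak{U}_{\mathbf{KR}_{2}}$ is the smallest $\sigma$-algebra on $\mathbb{Z}_{\geq1}$ containing all sets $\gamma^{-1}(w)$, $w\in\{a,b\}^{\ast}$.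 *)

(* Defs.v *)
From mathcomp Require Import all_boot.
From mathcomp Require Import all_classical all_reals all_analysis.

Set Implicit Arguments.
Unset Strict Implicit.
Unset Printing Implicit Defensive.

Local Open Scope classical_set_scope.
Local Open Scope nat_scope.

Definition even_trapezoidal (n : nat) : Prop :=
  exists a m : nat, [/\ 1 <= a, 1 <= m & n = \sum_(0 <= k < 2 * m) (a + k)].

(* The condition (x + y + z) / 2 = n is an equality of rationals, hence it is
   cleared of its denominator rather than stated with truncated division. *)
Definition pythagorean_semiperimeter (n : nat) : Prop :=
  exists x y z : nat,
    [/\ 1 <= x, 1 <= y, 1 <= z, x ^ 2 + y ^ 2 = z ^ 2 & x + y + z = 2 * n].

Inductive letter : Type := letter_a | letter_b.

Definition double_divisors (n : nat) : seq nat :=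
  [seq 2 * d | d <- divisors n].

(* The increasing enumeration u_1 < ... < u_k of the symmetric difference of
   D_n and 2 D_n; both lists are duplicate-free and the two filters are
   disjoint. *)
Definition symdiff_divisors (n : nat) : seq nat :=
  sort leq ([seq d <- divisors n | d \notin double_divisors n] ++
            [seq d <- double_divisors n | d \notin divisors n]).

(* On the symmetric difference, u \in D_n is equivalent to
   u \in D_n \ 2 D_n, and its negation to u \in 2 D_n \ D_n. *)
Definition KR2_word (n : nat) : seq letter :=
  [seq if u \in divisors n then letter_a else letter_b
  | u <- symdiff_divisors n].

Record coding_system : Type := CodingSystem {
  carrier : Type;
  alphabet : Type;
  coding : carrier -> seq alphabet }.

Definition coding_sigma_algebra (K : coding_system) : set (set (carrier K)) :=
  <<s [set A | exists w : seq (alphabet K), A = coding (c:=K) @^-1` [set w]] >>.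

Definition provable_eq (K : coding_system) (R S : set (carrier K)) : Prop :=
  [/\ coding_sigma_algebra R, coding_sigma_algebra S
    & coding (c:=K) @` R = coding (c:=K) @` S].

Definition pos_nat : Type := {n : nat | 1 <= n}.

Definition KR2 : coding_system :=
  @CodingSystem pos_nat letter (fun n => KR2_word (sval n)).

(* Main.v *)
(** If [n = 2^e q] with [q > 1] odd, then either [2^(e+1) < q], and [n] is a sum
    of [2 * 2^e] consecutive positive integers, or [2^i < q < 2^(i+1)] for some
    [i <= e], and [n = k r t] with [r = 2^i < t = q < 2 r] is the semi-perimeter
    of [k] times the Euclid triple of parameters [r] and [t - r].  Conversely,
    with [c := 2 m + 2 a - 1] an even-trapezoidal [n = m c] has the odd divisor
    [c > 1], and a triangle of semi-perimeter [n] satisfies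
    [(2n - x) (2n - y) = 2 n^2] with [n < 2n - x < 2n], so that [2 n^2] has a
    divisor strictly between [n] and [2n], impossible for [n = 2^e].
    Finally the powers of [2] are exactly the integers coded by the word [ab],
    since every odd divisor of [n] contributes a letter [a]. *)
Require Import Defs.
From mathcomp Require Import all_boot zify.
From mathcomp Require Import all_classical all_reals all_analysis.

Local Open Scope classical_set_scope.
Local Open Scope nat_scope.

Lemma even_trapezoidalP (n : nat) :
  even_trapezoidal n <->
  exists m c : nat, [/\ 1 <= m, odd c, 2 * m < c & n = m * c].
Proof.
have sumE a m : \sum_(0 <= k < 2 * m) (a + k) = m * (2 * a + 2 * m - 1).
  elim: m => [|m IHm]; first by rewrite muln0 big_nil.
  have -> : 2 * m.+1 = (2 * m).+2 by lia.
  rewrite !big_nat_recr //= IHm; nia.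
split=> [[a [m [a1 m1 ->]]]|[m [c [m1 oddc lt_mc ->]]]].
  by exists m, (2 * a + 2 * m - 1); split=> //; lia.
(* This solves [c = 2 * a + 2 * m - 1] for [a]; the division is exact because [c] is odd. *)
exists ((c - 2 * m).+1 %/ 2), m; split=> //; first lia.
by rewrite sumE; congr (_ * _); lia.
Qed.

Lemma pythagorean_semiperimeter_mul (k r t : nat) :
  0 < k -> r < t < 2 * r -> pythagorean_semiperimeter (k * r * t).
Proof.
move=> k0 /andP[lt_rt lt_t2r].
have [s st s0] : exists2 s, t = r + s & 0 < s by exists (t - r); lia.
have [d rd d0] : exists2 d, r = s + d & 0 < d by exists (r - s); lia.
subst t r.
(* As [r = s + d], the legs are [k (r^2 - s^2)], factored to avoid subtraction, and [2 k r s]; the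
   perimeter is [2 k r (r + s)]. *)
exists (k * (d * (2 * s + d))), (k * (2 * (s + d) * s)).
exists (k * ((s + d) ^ 2 + s ^ 2)); split; nia.
Qed.

Lemma pythagorean_semiperimeter_divisor (n : nat) :
  pythagorean_semiperimeter n -> exists2 d, n < d < 2 * n & d %| 2 * n ^ 2.
Proof.
move=> [x [y [z [x1 y1 z1 xyz per]]]].
have lt_xz : x < z by nia.
have lt_yz : y < z by nia.
exists (2 * n - x); first lia.
apply/dvdnP; exists (2 * n - y).
(* Here [u = y + z] and [v = x + z]; by [x^2 + y^2 = z^2], their product is half of
   [(x + y + z)^2]. *)
have [u nu] : exists u, 2 * n = x + u by exists (2 * n - x); lia.
have [v nv] : exists v, 2 * n = y + v by exists (2 * n - y); lia.
have -> : 2 * n - x = u by lia.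
have -> : 2 * n - y = v by lia.
nia.
Qed.

Lemma odd_dvdn_pow2 (c e : nat) : odd c -> c %| 2 ^ e -> c = 1.
Proof.
move=> oddc /(dvdn_pfactor _ _ (isT : prime 2))[[|i] _ cE] //.
by move: oddc; rewrite cE oddX.
Qed.

Lemma pow2_or_odd_part (n : nat) : 0 < n ->
  (exists m, n = 2 ^ m) \/ (exists e q, [/\ odd q, 1 < q & n = 2 ^ e * q]).
Proof.
move=> n0; have [[|q] cop ->] := pfactor_coprime (isT : prime 2) n0.
  by [].
rewrite coprime2n in cop; rewrite mulnC.
case: q cop => [|q] oddq; first by left; exists (logn 2 n); rewrite muln1.
by right; exists (logn 2 n), q.+2.
Qed.

Lemma even_trapezoidal_or_pythagorean (e q : nat) : odd q -> 1 < q ->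
  even_trapezoidal (2 ^ e * q) \/ pythagorean_semiperimeter (2 ^ e * q).
Proof.
move=> oddq q1; have [lt_eq|le_qe] := ltnP (2 ^ e.+1) q.
  left; apply/even_trapezoidalP; exists (2 ^ e), q.
  by rewrite -expnS expn_gt0.
right; have /andP[le_iq lt_qi] := trunc_log_bounds (isT : 1 < 2) (ltnW q1).
set i := trunc_log 2 q in le_iq lt_qi.
have neq_iq : 2 ^ i != q.
  apply/eqP => qE; have : q = 1 by apply: (@odd_dvdn_pow2 _ i) => //; rewrite qE.
  by lia.
have lt_iq : 2 ^ i < q by rewrite ltn_neqAle neq_iq.
(* From [2^i < q <= 2^(e+1)] follows [i <= e], so [2^(e-i)] can serve as the scaling factor [k]. *)
have lt_ie : i < e.+1 by rewrite -(ltn_exp2l _ _ (isT : 1 < 2)) (leq_trans lt_iq).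
have -> : 2 ^ e = 2 ^ (e - i) * 2 ^ i by rewrite -expnD subnK.
apply: pythagorean_semiperimeter_mul; first by rewrite expn_gt0.
by rewrite lt_iq -expnS.
Qed.

Lemma pow2P (n : nat) : 1 <= n ->
  ((exists m : nat, n = 2 ^ m) <->
   (~ even_trapezoidal n /\ ~ pythagorean_semiperimeter n)).
Proof.
move=> n1; split=> [[e nE]|[ntrap npyth]].
  split.
    case/even_trapezoidalP=> m [c [m1 oddc lt_mc ncE]].
    suff : c = 1 by lia.
    by apply: (@odd_dvdn_pow2 _ e); rewrite // -nE ncE dvdn_mull.
  move/pythagorean_semiperimeter_divisor=> [d /andP[lt_nd lt_dn]].
  (* The divisor [d] of [2^(2e+1)] is some [2^i], and the bounds would force [e < i < e + 1]. *)
  rewrite nE -expnM -expnS => /(dvdn_pfactor _ _ (isT : prime 2))[i _ dE].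
  by move: lt_nd lt_dn; rewrite nE dE -expnS !ltn_exp2l //; lia.
have [//|[e [q [oddq q1 nE]]]] := pow2_or_odd_part _ n1.
by have [] := even_trapezoidal_or_pythagorean e _ oddq q1; rewrite -nE.
Qed.

Lemma mem_symdiff_divisors (n u : nat) :
  (u \in symdiff_divisors n) =
  ((u \in divisors n) (+) (u \in double_divisors n)).
Proof.
by rewrite mem_sort mem_cat !mem_filter; do 2!case: (_ \in _).
Qed.

Lemma symdiff_divisors_uniq (n : nat) : uniq (symdiff_divisors n).
Proof.
rewrite sort_uniq cat_uniq !filter_uniq ?divisors_uniq //; last first.
  by rewrite map_inj_uniq ?divisors_uniq // => x y /eqP; rewrite eqn_pmul2l // => /eqP.
rewrite andbT; apply/hasPn => u; rewrite !mem_filter => /andP[/negbTE -> _].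
by rewrite andbF.
Qed.

Lemma mem_double_divisors (n u : nat) : 0 < n ->
  (u \in double_divisors n) = ~~ odd u && (u./2 %| n).
Proof.
move=> n0; apply/mapP/andP => [[d dn ->]|[evu dvdu]].
  by rewrite mul2n odd_double doubleK dvdn_divisors.
by exists u./2; rewrite -?dvdn_divisors // mul2n even_halfK.
Qed.

Lemma odd_divisor_mem_symdiff (n u : nat) : 0 < n -> odd u -> u %| n ->
  u \in symdiff_divisors n.
Proof.
by move=> n0 oddu un; rewrite mem_symdiff_divisors mem_double_divisors // oddu
  -dvdn_divisors // un.
Qed.

(** The divisors are [1, 2, ..., 2^m] and their doubles [2, ..., 2^(m+1)], so only the two extremes
    survive. *)
Lemma symdiff_divisors_pow2 (m : nat) :
  symdiff_divisors (2 ^ m) = [:: 1; 2 ^ m.+1].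
Proof.
have n0 : 0 < 2 ^ m by rewrite expn_gt0.
apply: (sorted_eq leq_trans anti_leq); first exact/sort_sorted/leq_total.
  by rewrite /= expn_gt0.
apply: uniq_perm; first exact: symdiff_divisors_uniq.
  by rewrite /= inE andbT -[1]/(2 ^ 0) eqn_exp2l.
move=> u; rewrite mem_symdiff_divisors mem_double_divisors // -dvdn_divisors //.
rewrite !inE.
have [oddu|evu] /= := boolP (odd u).
  rewrite addbF; have -> : (u == 2 ^ m.+1) = false.
    by apply/eqP => uE; move: oddu; rewrite uE oddX.
  rewrite orbF; apply/idP/eqP => [|->]; [exact: odd_dvdn_pow2|exact: dvd1n].
rewrite -(even_halfK evu) doubleK; move: u./2 => {u evu} v.
have -> : (v.*2 == 1) = false by lia.
rewrite expnS -mul2n eqn_pmul2l //=.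
(* For [u = 2 v] with [v] other than [2^m], [v] and [2 v] divide [2^m] simultaneously, so [u]
   cancels. *)
have [vE|nv] := eqVneq v (2 ^ m).
  by rewrite vE dvdnn addbT -expnS dvdn_Pexp2l // ltnn.
suff -> : (2 * v %| 2 ^ m) = (v %| 2 ^ m) by rewrite addbb.
apply/idP/idP => [dv|vm].
  exact: dvdn_trans (dvdn_mull 2 (dvdnn v)) dv.
have /(dvdn_pfactor _ _ (isT : prime 2))[i im vE] := vm.
rewrite vE -expnS dvdn_Pexp2l // ltn_neqAle im andbT.
by apply: contraNneq nv => <-; rewrite vE.
Qed.

Lemma KR2_word_pow2P (n : nat) : 0 < n ->
  KR2_word n = [:: letter_a; letter_b] <-> exists m, n = 2 ^ m.
Proof.
move=> n0; split=> [|[m ->]]; last first.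
  have m0 : 0 < 2 ^ m by rewrite expn_gt0.
  rewrite /KR2_word symdiff_divisors_pow2 /= -!dvdn_divisors // dvd1n.
  by rewrite dvdn_Pexp2l // ltnn.
have [//|[e [q [oddq q1 nE]]]] := pow2_or_odd_part _ n0.
have qn : q %| n by rewrite nE dvdn_mull.
have := odd_divisor_mem_symdiff _ _ n0 (isT : odd 1) (dvd1n n).
have := odd_divisor_mem_symdiff _ _ n0 oddq qn.
(* The entry [v] coded by the letter b is not a divisor of [n], so the divisors [1] and [q] must
   both be the first entry [u], against [q > 1]. *)
rewrite /KR2_word; case: (symdiff_divisors n) => [|u [|v [|? ?]]] //.
rewrite !inE => qE oneE [_].
case: ifP => // vn _; move: qE oneE.
have neq d : d %| n -> (d == v) = false.
  by move=> dn; apply/eqP => dv; rewrite -dv -dvdn_divisors // dn in vn.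
by rewrite !neq // !orbF => /eqP qu /eqP u1; rewrite qu -u1 in q1.
Qed.

Theorem theorem21 :
  (forall n : nat, 1 <= n ->
     ((exists m : nat, n = 2 ^ m) <->
      (~ even_trapezoidal n /\ ~ pythagorean_semiperimeter n)))
  /\
  @provable_eq KR2
    [set n : pos_nat | exists m : nat, sval n = 2 ^ m]
    [set n : pos_nat | ~ even_trapezoidal (sval n) /\
                       ~ pythagorean_semiperimeter (sval n)].
Proof.
split; first exact: pow2P.
set R := [set n | exists _, _]; set S := [set n | _ /\ _].
have <- : R = S by apply/seteqP; split=> -[n n1] /=; apply pow2P.
suff RU : @coding_sigma_algebra KR2 R by split.
(* [R] is the fibre of the coding over the word ab, hence one of the generators. *)
apply: sub_sigma_algebra; exists [:: letter_a; letter_b].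
by apply/seteqP; split=> -[n n1] /=; apply KR2_word_pow2P.
Qed.
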